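(* As formal power series in $z$, $$\sum_{n\ge 1} \tilde W_n(\mathbf{x},t) z^n = \frac{\sum_{i\ge 1} i\,t^{i-1} e_i(\mathbf{x}) z^i}{1-\sum_{i\ge 2} t[i-1]_t\, e_i(\mathbf{x}) z^i}.$$ Consequently, $\tilde W_n(\mathbf{x},t)$ is $e$-positive for all $n\ge 1$.
   Context: For $n\ge 1$, $W_n$ is the set of Smirnov words of length $n$: words $w=w_1\cdots w_n$ over the positive integers with $w_i\ne w_{i+1}$ for all $1\le i\le n-1$ (the first and last letters may be equal). Let $\mathbf{x}=x_1,x_2,\dots$ be indeterminates and $x_w:=x_{w_1}\cdots x_{w_n}$. The cyclic descent number is $\mathrm{cdes}(w):=|\{i\in\{1,\dots,n\}: w_i>w_{i+1}\}|$, where $w_{n+1}:=w_1$. Define $\tilde W_n(\mathbf{x},t):=\sum_{w\in W_n} t^{\mathrm{cdes}(w)}x_w$. Here $e_i(\mathbf{x})$ is the elementary symmetric function of degree $i$ and $[m]_t:=1+t+\cdots+t^{m-1}$. A polynomial in $t$ is $e$-positive if all of its coefficients are symmetric functions whose expansion in the elementary symmetric function basis has nonnegative coefficients. *)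

(* Defs.v *)
From HB Require Import structures.
From mathcomp Require Import all_boot all_order all_algebra.
From mathcomp Require Import finmap multiset.
From mathcomp Require Import boolp.
From mathcomp Require Import zify.

Set Implicit Arguments.
Unset Strict Implicit.
Unset Printing Implicit Defensive.

Import GRing.Theory.
Local Open Scope ring_scope.
Local Open Scope mset_scope.

(** * Formal power series in the indeterminates x_1, x_2, ... *)

(* Positive integers: the alphabet, and the index set of the indeterminates. *)
Definition letter : choiceType := {k : nat | (0 < k)%N}.

(* A monomial is the multiset of the indices of its indeterminates, with
   multiplicity.  A series is its coefficient function; its ring structure is
   the convolution product below, not the pointwise one. *)
Definition xseries (R : Type) : Type := {mset letter} -> R.

(* The divisors of a monomial, see [mem_mdivs]. *)
Definition mdivs (A : {mset letter}) : seq {mset letter} :=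
  undup [seq seq_mset (mask (val m) A) | m : (size A).-tuple bool].

Lemma mem_mdivs (A B : {mset letter}) : (B \in mdivs A) = (B `<=` A)%mset.
Proof.
rewrite mem_undup; apply/mapP/msubsetP => [[m _ ->] a | sBA].
  rewrite mset_seqE -[X in (_ <= X)%N]count_mem_mset.
  by apply/count_subseqP: a; exists (mask m A) => //; apply: mask_subseq.
have /count_subseqP[s /subseqP[m sz_m ->] eqBs] :
    forall a, (count_mem a B <= count_mem a A)%N.
  by move=> a; rewrite !count_mem_mset.
exists (Tuple (introT eqP sz_m)); first by rewrite mem_enum.
by rewrite -[LHS]seq_mset_id; apply/eq_seq_msetP.
Qed.

Lemma mdivs_uniq (A : {mset letter}) : uniq (mdivs A).
Proof. exact: undup_uniq. Qed.

Section XSeriesRing.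
Variable R : comNzRingType.
Implicit Types (f g h : xseries R) (A B C : {mset letter}) (a b : R).

HB.instance Definition _ := gen_eqMixin (xseries R).
HB.instance Definition _ := gen_choiceMixin (xseries R).

Definition xzero : xseries R := fun=> 0.
Definition xopp f : xseries R := fun A => - f A.
Definition xadd f g : xseries R := fun A => f A + g A.
Definition xone : xseries R := fun A => (A == mset0)%:R.
Definition xmul f g : xseries R :=
  fun A => \sum_(B <- mdivs A) f B * g (A `\` B).
Definition xscale a f : xseries R := fun A => a * f A.

Fact xaddA : associative xadd.
Proof. by move=> f g h; apply/funext => A; apply: addrA. Qed.
Fact xaddC : commutative xadd.
Proof. by move=> f g; apply/funext => A; apply: addrC. Qed.
Fact xadd0 : left_id xzero xadd.
Proof. by move=> f; apply/funext => A; apply: add0r. Qed.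
Fact xaddN : left_inverse xzero xopp xadd.
Proof. by move=> f; apply/funext => A; apply: addNr. Qed.

HB.instance Definition _ :=
  GRing.isZmodule.Build (xseries R) xaddA xaddC xadd0 xaddN.

Fact xmulC : commutative xmul.
Proof.
move=> f g; apply/funext => A; rewrite /xmul.
have eqA : perm_eq (mdivs A) [seq A `\` B | B <- mdivs A].
  apply: uniq_perm; first exact: mdivs_uniq.
    rewrite map_inj_in_uniq ?mdivs_uniq // => B C.
    by rewrite !mem_mdivs => /msetBBK {2}<- /msetBBK {2}<- ->.
  move=> B; rewrite mem_mdivs; apply/idP/mapP => [sBA | [C _ ->]].
    by exists (A `\` B); rewrite ?mem_mdivs ?msubsetDl ?msetBBK.
  exact: msubsetDl.
rewrite (perm_big _ eqA) big_map; rewrite big_seq [RHS]big_seq.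
by apply: eq_bigr => B; rewrite mem_mdivs => sBA; rewrite msetBBK // mulrC.
Qed.

Fact xmulA : associative xmul.
Proof.
move=> f g h; apply/funext => A; rewrite /xmul; symmetry.
have step1 B : B \in mdivs A ->
    (\sum_(C <- mdivs B) f C * g (B `\` C)) * h (A `\` B) =
    \sum_(C <- mdivs A | (C `<=` B)%mset) f C * g (B `\` C) * h (A `\` B).
  rewrite mem_mdivs => sBA; rewrite mulr_suml -[RHS]big_filter.
  apply: perm_big; apply: uniq_perm; rewrite ?filter_uniq ?mdivs_uniq //.
  move=> C; rewrite mem_filter !mem_mdivs; case sCB: (C `<=` B)%mset => //=.
  by rewrite (msubset_trans sCB sBA).
rewrite big_seq (eq_bigr _ step1) -big_seq (exchange_big_dep predT) /=; last by [].
rewrite big_seq [RHS]big_seq; apply: eq_bigr => C; rewrite mem_mdivs => sCA.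
rewrite mulr_sumr -big_filter.
have eqA : perm_eq [seq B <- mdivs A | (C `<=` B)%mset]
                   [seq C `+` D | D <- mdivs (A `\` C)].
  apply: uniq_perm; rewrite ?filter_uniq ?mdivs_uniq //.
    rewrite map_inj_uniq ?mdivs_uniq //; exact: can_inj (msetDKB C).
  move=> B; rewrite mem_filter mem_mdivs; apply/andP/mapP => [[sCB sBA]|[D]].
    by exists (B `\` C); rewrite ?mem_mdivs ?msetSB ?msetBDKC.
  rewrite mem_mdivs => /(msetDS C); rewrite msetBDKC // => sA ->; split=> //.
  by apply/msubsetP => a; rewrite msetE2 leq_addr.
rewrite (perm_big _ eqA) big_map; apply: eq_bigr => D _.
by rewrite msetBDA msetDKB mulrA.
Qed.

Fact xmul1 : left_id xone xmul.
Proof.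
move=> f; apply/funext => A; rewrite /xmul.
rewrite (bigD1_seq mset0) ?mdivs_uniq ?mem_mdivs ?msub0set //=.
rewrite /xone eqxx mul1r msetB0 big1 ?addr0 // => B /negPf->.
by rewrite mul0r.
Qed.

Fact xmulDl : left_distributive xmul xadd.
Proof.
move=> f g h; apply/funext => A; rewrite /xmul /xadd -big_split /=.
by apply: eq_bigr => B _; rewrite mulrDl.
Qed.

Fact xone_neq0 : xone != 0.
Proof.
apply/eqP => /(congr1 (fun f => f mset0)) /eqP.
by rewrite /xone eqxx oner_eq0.
Qed.

HB.instance Definition _ := GRing.Zmodule_isComNzRing.Build (xseries R)
  xmulA xmulC xmul1 xmulDl xone_neq0.

Fact xscaleA a b f : xscale a (xscale b f) = xscale (a * b) f.
Proof. by apply/funext => A; apply: mulrA. Qed.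
Fact xscale1 : left_id 1 xscale.
Proof. by move=> f; apply/funext => A; apply: mul1r. Qed.
Fact xscaleDr : right_distributive xscale +%R.
Proof. by move=> a f g; apply/funext => A; apply: mulrDr. Qed.
Fact xscaleDl f : {morph xscale^~ f : a b / a + b}.
Proof. by move=> a b; apply/funext => A; apply: mulrDl. Qed.

HB.instance Definition _ := GRing.Zmodule_isLmodule.Build R (xseries R)
  xscaleA xscale1 xscaleDr xscaleDl.

(* The series \sum_(w | P w) c w * x_w over all words w, where
   x_w = x_(w_1) ... x_(w_n); [permutations A] lists without repetition the
   finitely many words w such that x_w is the monomial A. *)
Definition word_sum (P : pred (seq letter)) (c : seq letter -> R) : xseries R :=
  fun A => \sum_(w <- permutations A | P w) c w.

Definition elem_sym (i : nat) : xseries R :=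
  word_sum
    (fun w => (size w == i) && sorted (fun k l : letter => (val k < val l)%N) w)
    (fun=> 1).

(* Invariant under all permutations of the indeterminates, of bounded degree. *)
Definition is_symmetric_function (f : xseries R) : Prop :=
  (exists d : nat, forall A, (d < size A)%N -> f A = 0) /\
  (forall (s : letter -> letter) A,
      bijective s -> f (seq_mset [seq s k | k <- A]) = f A).

Definition elem_sym_part (la : seq nat) : xseries R :=
  \prod_(i <- la) elem_sym i.

End XSeriesRing.

Definition is_intpart (la : seq nat) : bool := sorted geq la && (0%N \notin la).

Definition e_nonneg (f : xseries int) : Prop :=
  is_symmetric_function f /\
  exists (P : seq (seq nat)) (c : seq nat -> int),
    [/\ uniq P,
        all is_intpart P,
        forall la, la \in P -> 0 <= c la
      & f = \sum_(la <- P) c la *: elem_sym_part int la].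

(* A series over Z[t] read as a polynomial in t over series. *)
Definition t_coef (k : nat) (f : xseries {poly int}) : xseries int :=
  fun A => (f A)`_k.

Definition e_positive (f : xseries {poly int}) : Prop :=
  (exists d : nat, forall k, (d < k)%N -> t_coef k f = 0) /\
  (forall k, e_nonneg (t_coef k f)).

(** * Smirnov words *)

Definition smirnov (n : nat) (w : seq letter) : bool :=
  (size w == n) && sorted (fun k l => k != l) w.

(* [zip w (rot 1 w)] lists the pairs (w_i, w_(i+1)) with w_(n+1) = w_1. *)
Definition cdes (w : seq letter) : nat :=
  count (fun p => (val p.2 < val p.1)%N) (zip w (rot 1 w)).

Definition smirnov_enum (n : nat) : xseries {poly int} :=
  word_sum (smirnov n) (fun w => 'X^(cdes w)).

Definition t_int (m : nat) : {poly int} := \sum_(j < m) 'X^j.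

(** * Formal power series in z *)

Definition zseries (R : Type) : Type := nat -> R.

Section ZSeriesRing.
Variable R : comNzRingType.
Implicit Types f g h : zseries R.

HB.instance Definition _ := gen_eqMixin (zseries R).
HB.instance Definition _ := gen_choiceMixin (zseries R).

Definition zzero : zseries R := fun=> 0.
Definition zopp f : zseries R := fun n => - f n.
Definition zadd f g : zseries R := fun n => f n + g n.
Definition zone : zseries R := fun n => (n == 0%N)%:R.
Definition zmul f g : zseries R := fun n => \sum_(i < n.+1) f i * g (n - i)%N.

Fact zaddA : associative zadd.
Proof. by move=> f g h; apply/funext => n; apply: addrA. Qed.
Fact zaddC : commutative zadd.
Proof. by move=> f g; apply/funext => n; apply: addrC. Qed.
Fact zadd0 : left_id zzero zadd.
Proof. by move=> f; apply/funext => n; apply: add0r. Qed.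
Fact zaddN : left_inverse zzero zopp zadd.
Proof. by move=> f; apply/funext => n; apply: addNr. Qed.

HB.instance Definition _ :=
  GRing.isZmodule.Build (zseries R) zaddA zaddC zadd0 zaddN.

Lemma zmul_poly N f g n : (n <= N)%N ->
  zmul f g n = ((\poly_(i < N.+1) f i) * (\poly_(i < N.+1) g i))`_n.
Proof.
move=> le_nN; rewrite coefM; apply: eq_bigr => i _; rewrite !coef_poly.
have le_in : (i <= n)%N by rewrite -ltnS.
by rewrite !ltnS (leq_trans le_in le_nN) (leq_trans (leq_subr _ _) le_nN).
Qed.

Fact zmulC : commutative zmul.
Proof.
by move=> f g; apply/funext => n; rewrite !(@zmul_poly n) // mulrC.
Qed.

Fact zmulA : associative zmul.
Proof.
move=> f g h; apply/funext => n.
transitivity ((\poly_(i < n.+1) f i * (\poly_(i < n.+1) g i *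
               \poly_(i < n.+1) h i))`_n).
  rewrite coefM; apply: eq_bigr => i _.
  by rewrite coef_poly ltn_ord (@zmul_poly n) // leq_subr.
rewrite mulrA coefM; apply: eq_bigr => i _.
by rewrite [X in _ * X]coef_poly ltnS leq_subr (@zmul_poly n) // -ltnS.
Qed.

Fact zmul1 : left_id zone zmul.
Proof.
move=> f; apply/funext => n; rewrite /zmul big_ord_recl subn0 mul1r.
by rewrite big1 ?addr0 // => i _; rewrite mul0r.
Qed.

Fact zmulDl : left_distributive zmul zadd.
Proof.
move=> f g h; apply/funext => n; rewrite /zmul /zadd -big_split /=.
by apply: eq_bigr => i _; rewrite mulrDl.
Qed.

Fact zone_neq0 : zone != 0.
Proof.
by apply/eqP => /(congr1 (fun f => f 0%N)) /eqP; rewrite /zone oner_eq0.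
Qed.

HB.instance Definition _ := GRing.Zmodule_isComNzRing.Build (zseries R)
  zmulA zmulC zmul1 zmulDl zone_neq0.

(* Inverses exist exactly for the invertible series; as for any MathComp unit
   ring, the inverse of a non-unit is itself. *)
Definition zunit : {pred zseries R} := fun f => `[< exists g, g * f = 1 >].

Definition zinv f : zseries R :=
  if pselect (exists g, g * f = 1) is left fU then projT1 (cid fU) else f.

Fact zmulV : {in zunit, left_inverse 1 zinv *%R}.
Proof.
by move=> f /asboolP fU; rewrite /zinv; case: pselect => // ?; case: cid.
Qed.

Fact zunitP f g : g * f = 1 -> zunit f.
Proof. by move=> gf; apply/asboolP; exists g. Qed.

Fact zinv_out : {in [predC zunit], zinv =1 id}.
Proof. by move=> f /asboolPn nU; rewrite /zinv; case: pselect. Qed.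

HB.instance Definition _ :=
  GRing.ComNzRing_hasMulInverse.Build (zseries R) zmulV zunitP zinv_out.

(* The series \sum_(n >= m) a_n z^n. *)
Definition zsum (m : nat) (a : nat -> R) : zseries R :=
  fun n => if (m <= n)%N then a n else 0.

(* The quotients by 1 - \sum_(n >= m) a_n z^n with 0 < m are genuine ones. *)
Lemma zsum_unit m (a : nat -> R) :
  (0 < m)%N -> 1 - zsum m a \is a GRing.unit.
Proof.
move=> m_gt0; set d := zsum m a.
have d0 : d 0%N = 0 by rewrite /d /zsum leqn0 -if_neg -lt0n m_gt0.
have dX k : forall n, (n < k)%N -> (d ^+ k) n = 0.
  elim: k => // k IHk n lt_nk; rewrite exprS.
  rewrite [LHS]big_ord_recl d0 mul0r add0r big1 // => i _.
  by rewrite IHk ?mulr0 // lift0; case: n i lt_nk => [[]|n i] //=; lia.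
pose g : zseries R := fun n => (\sum_(k < n.+1) d ^+ k) n.
have sumE (I : Type) (r : seq I) (F : I -> zseries R) n :
    (\sum_(i <- r) F i) n = \sum_(i <- r) F i n.
  by elim/big_rec2: _ => // i y1 y2 _ <-.
have gE N n : (n <= N)%N -> g n = (\sum_(k < N.+1) d ^+ k) n.
  move=> le_nN; rewrite /g !sumE.
  rewrite (big_ord_widen N.+1 (fun k => (d ^+ k) n)) // big_mkcond /=.
  apply: eq_bigr => k _; case: ltnP => // lt_nk; symmetry; exact: dX.
suff gd : g * (1 - d) = 1 by apply/asboolP; exists g.
apply/funext => n.
transitivity (((\sum_(k < n.+1) d ^+ k) * (1 - d)) n).
  by apply: eq_bigr => i _; rewrite (gE n) // -ltnS.
have -> : (\sum_(k < n.+1) d ^+ k) * (1 - d) = 1 - d ^+ n.+1.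
  by rewrite mulrC -opprB mulNr -subrX1 opprB.
have -> : (1 - d ^+ n.+1) n = (1 : zseries R) n - (d ^+ n.+1) n by [].
by rewrite dX // subr0.
Qed.

End ZSeriesRing.

(* Main.v *)
(* Let [t = 'X].  Fix a letter [r] and let [P_j] enumerate the nonempty Smirnov
   words ending in [r] by [t^des], with one more factor [t] if the first letter
   is among the [j] smallest ones.  Removing the first letter of a word gives
     P_(j+1) (1 + x_j) = P_j (1 + t x_j) - [j = r] (1 - t) x_j,
   [x_j] being the variable of the letter of index [j] (from 0).  From [j = 0]
   to infinity, where P_oo = t P_0, this telescopes to
     P_0 (E(t) - t E(1))
       = (1 - t) x_r \prod_(a < r) (1 + x_a) \prod_(a > r) (1 + t x_a),
   where E(p) = \prod_a (1 + p x_a); stopping at [j = r] expresses [P_r] through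
   [P_0], whence
     P_r (E(t) - t E(1)) = (1 - t) x_r \prod_(a <> r) (1 + t x_a).
   Now [P_r] counts the words ending in [r] by [t^cdes].  Summing over [r] and
   cancelling [1 - t] gives the generating function, the variable [z] being
   restored by homogeneity.  The resulting recurrence
     W_n = n t^(n-1) e_n + \sum_(i >= 2) t [i-1]_t e_i W_(n-i)
   has nonnegative coefficients, hence the e-positivity. *)
Require Import Defs.
From mathcomp Require Import all_boot all_order all_algebra.
From mathcomp Require Import finmap multiset boolp.
From mathcomp Require Import zify ring.

Set Implicit Arguments.
Unset Strict Implicit.
Unset Printing Implicit Defensive.

Import Order.TTheory GRing.Theory Num.Theory.
Local Open Scope ring_scope.
Local Open Scope mset_scope.

(** * Multisets as monomials: divisors and degrees *)

Lemma perm_msetD (A B : {mset letter}) : perm_eq (A `+` B) (A ++ B).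
Proof.
by apply/allP => a _ /=; rewrite count_cat !count_mem_mset msetE2.
Qed.

Lemma perm_msubset (A B : {mset letter}) :
  (B `<=` A)%mset -> perm_eq A (B ++ (A `\` B)).
Proof. by move=> sBA; rewrite -{1}(msetBDKC sBA) perm_msetD. Qed.

Lemma size_msubset (A B : {mset letter}) :
  (B `<=` A)%mset -> size A = (size B + size (A `\` B))%N.
Proof. by move/perm_msubset/perm_size; rewrite size_cat. Qed.

Lemma mset_uniqP (A : {mset letter}) : reflect (forall a, (A a <= 1)%N) (uniq A).
Proof.
apply: (iffP idP) => [uA a | leA1]; last first.
  apply/count_mem_uniq => a; rewrite count_mem_mset; have := leA1 a.
  by rewrite in_mset; case: (A a) => [|[]].
by rewrite -count_mem_mset count_uniq_mem ?leq_b1.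
Qed.

(** * Series in the variables: cancellation, products, sums over words *)

Section XSeries.
Variable R : comNzRingType.
Implicit Types (f g u : xseries R) (A B : {mset letter}) (a r : letter) (p t : R).

Lemma xaddE f g A : (f + g) A = f A + g A. Proof. by []. Qed.
Lemma xoppE f A : (- f) A = - f A. Proof. by []. Qed.
Lemma xoneE A : (1 : xseries R) A = (A == mset0)%:R. Proof. by []. Qed.
Lemma xscaleE p f A : (p *: f) A = p * f A. Proof. by []. Qed.
Lemma xmulE f g A : (f * g) A = \sum_(B <- mdivs A) f B * g (A `\` B).
Proof. by []. Qed.

Lemma xsumE (I : Type) (s : seq I) (F : I -> xseries R) A :
  (\sum_(i <- s) F i) A = \sum_(i <- s) F i A.
Proof. by elim/big_rec2: _ => // i y1 y2 _ <-. Qed.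

Lemma xscaleAl p f g : (p *: f) * g = p *: (f * g).
Proof.
apply/funext => A; rewrite xscaleE !xmulE mulr_sumr.
by apply: eq_bigr => B _; rewrite xscaleE mulrA.
Qed.

Lemma eq_xmul f f' g g' A :
    (forall B, (B `<=` A)%mset -> f B = f' B) ->
    (forall B, (B `<=` A)%mset -> g B = g' B) ->
  (f * g) A = (f' * g') A.
Proof.
move=> eqf eqg; rewrite !xmulE big_seq [RHS]big_seq.
by apply: eq_bigr => B; rewrite mem_mdivs => sBA; rewrite eqf ?eqg ?msubsetDl.
Qed.

(** With [h = f - g], the divisor [A] contributes [h A] to the coefficient of [h * u] at [A], and
    all other divisors have smaller degree. Strong induction on the degree gives [h = 0]. *)
Lemma xmul_cancel u f g : u mset0 = 1 -> f * u = g * u -> f = g.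
Proof.
move=> u0 eqfg; apply/eqP; rewrite -subr_eq0; apply/eqP.
have : (f - g) * u = 0 by rewrite mulrBl eqfg subrr.
move: (f - g) => h hu0; apply/funext => A.
have [n] := ubnP (size A); elim: n A => // n IHn A; rewrite ltnS => leAn.
have := congr1 (fun f => f A) hu0; rewrite /= xmulE.
rewrite (bigD1_seq A) ?mem_mdivs ?mdivs_uniq ?msubset_refl //=.
rewrite msetBxx u0 mulr1 big_seq_cond big1 ?addr0 // => B.
rewrite mem_mdivs => /andP[sBA neBA]; rewrite IHn ?mul0r //.
apply: leq_trans leAn; rewrite (size_msubset sBA) -[X in (X < _)%N]addn0 ltn_add2l.
rewrite lt0n size_mset_eq0 msetB_eq0; apply: contra neBA => sAB.
by rewrite eqEmsubset sBA.
Qed.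

Definition xvar a : xseries R := fun A => (A == [mset a])%:R.

Lemma xvar_mulE a f A : (xvar a * f) A = if a \in A then f (A `\ a) else 0.
Proof.
rewrite xmulE; case: ifP => aA; last first.
  rewrite big_seq big1 // => B; rewrite mem_mdivs /xvar => sBA.
  by case: eqP => [eqB|]; rewrite ?mul0r //; rewrite eqB msub1set aA in sBA.
rewrite (bigD1_seq [mset a]) ?mem_mdivs ?msub1set ?mdivs_uniq //= /xvar eqxx.
by rewrite mul1r big1 ?addr0 // => B /negPf->; rewrite mul0r.
Qed.

(* The (possibly infinite) product of the [1 + p x_a] over the [a] satisfying [I]. *)
Definition eset p (I : pred letter) : xseries R :=
  fun A => if uniq A && all I A then p ^+ size A else 0.

Lemma uniq_all_msetP (I : pred letter) A :
  reflect (forall a, (A a <= I a)%N) (uniq A && all I A).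
Proof.
apply: (iffP andP) => [[/mset_uniqP uA /allP IA] a | leA].
  have := uA a; case aA: (a \in A); first by rewrite (IA _ aA).
  by move/negbT: aA => /mset_eq0P->.
split; first by apply/mset_uniqP => a; apply: leq_trans (leA a) (leq_b1 _).
by apply/allP => a; rewrite in_mset; have := leA a; case: (I a) => //; lia.
Qed.

Lemma eset0 p I : eset p I mset0 = 1.
Proof. by rewrite /eset enum_mset0 /= expr0. Qed.

Lemma eset_eq p (I J : pred letter) : I =1 J -> eset p I = eset p J.
Proof. by move=> eqIJ; apply/funext => A; rewrite /eset (eq_all eqIJ). Qed.

(** A squarefree monomial on two disjoint sets of letters splits in exactly one way into a part on
    each set, so the convolution has at most one nonzero term. *)
Lemma esetU p (I J : pred letter) :
  (forall a, ~~ (I a && J a)) -> eset p I * eset p J = eset p (predU I J).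
Proof.
move=> disIJ; apply/funext => A; rewrite xmulE /eset.
case: uniq_all_msetP => /= [leA | nleA]; last first.
  rewrite big_seq big1 // => B; rewrite mem_mdivs => sBA.
  case: uniq_all_msetP => [leB|]; last by rewrite mul0r.
  case: uniq_all_msetP => [leC|]; last by rewrite mulr0.
  case: nleA => a; have := leB a; have := leC a; have := disIJ a.
  by rewrite msetE2; case: (I a) => //; case: (J a) => //=; lia.
pose B0 := seq_mset [seq a <- A | I a].
have B0E a : B0 a = (I a * A a)%N.
  rewrite mset_seqE count_filter -count_mem_mset.
  case Ia: (I a); rewrite ?mul1n ?mul0n.
    by apply: eq_count => b /=; case: eqP => // ->; rewrite Ia.
  by rewrite (@eq_count _ _ pred0) ?count_pred0 // => b /=; case: eqP => // ->.
have sB0 : (B0 `<=` A)%mset.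
  by apply/msubsetP => a; rewrite B0E; case: (I a); rewrite ?mul1n ?mul0n.
rewrite (bigD1_seq B0) ?mem_mdivs ?mdivs_uniq //=.
have /uniq_all_msetP -> : forall a, (B0 a <= I a)%N.
  by move=> a; have := leA a; rewrite B0E /=; case: (I a) => /=; lia.
have /uniq_all_msetP -> : forall a, ((A `\` B0) a <= J a)%N.
  move=> a; have := leA a; rewrite msetE2 B0E /=.
  by case: (I a) => /=; case: (J a) => /=; lia.
rewrite -exprD -size_msubset // big_seq_cond big1 ?addr0 // => B.
rewrite mem_mdivs => /andP[/msubsetP sBA neB].
case: uniq_all_msetP => [leB|]; last by rewrite mul0r.
case: uniq_all_msetP => [leC|]; last by rewrite mulr0.
case/eqP: neB; apply/msetP => a.
have := leB a; have := leC a; have := disIJ a; have := sBA a.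
by rewrite msetE2 B0E; case: (I a) => //; case: (J a) => //=; lia.
Qed.

(** Scalars are embedded as series so that [ring] can handle both together. *)
Definition xconst p : xseries R := p *: (1 : xseries R).

Lemma xconst_mul p f : xconst p * f = p *: f.
Proof. by rewrite xscaleAl mul1r. Qed.

Lemma xconst1 : xconst 1 = 1. Proof. exact: scale1r. Qed.

Lemma xconstB p q : xconst (p - q) = xconst p - xconst q.
Proof. exact: scalerBl. Qed.

Lemma mset1_neq0 a : [mset a] == mset0 = false :> bool.
Proof. by apply/eqP => /msetP/(_ a); rewrite msetnxx mset0E. Qed.

Lemma eset1 p a : eset p (pred1 a) = 1 + xconst p * xvar a.
Proof.
apply/funext => A; rewrite xaddE xconst_mul xscaleE xoneE /xvar.
have [->|A0] := eqVneq A mset0.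
  by rewrite eset0 eq_sym mset1_neq0 mulr0 addr0.
have [->|A1] := eqVneq A [mset a].
  by rewrite /eset enum_msetn /= eqxx mulr1 add0r expr1.
rewrite mulr0 addr0 /eset; case: uniq_all_msetP => // leA.
have [Aa|Aa] := posnP (A a).
  case/eqP: A0; apply/msetP => b; have := leA b; rewrite mset0E /=.
  by case: eqP => [->|_]; [rewrite Aa | case: (A b)].
case/eqP: A1; apply/msetP => b; have := leA b; rewrite msetnE /=.
case: eqP => [-> leA1|_]; last by case: (A b).
by apply/eqP; rewrite eqn_leq leA1 Aa.
Qed.

(** The Smirnov condition moves into the weight [c], so identities between series reduce to
    identities between weights of single words. *)
Definition wsum (c : seq letter -> R) : xseries R := word_sum predT c.

Lemma wsum_mset0 c : wsum c mset0 = c [::].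
Proof. by rewrite /wsum /word_sum enum_mset0 big_seq1. Qed.

Lemma wsumD c d : wsum c + wsum d = wsum (fun w => c w + d w).
Proof. by apply/funext => A; rewrite xaddE /wsum /word_sum -big_split. Qed.

Lemma wsumN c : - wsum c = wsum (fun w => - c w).
Proof. by apply/funext => A; rewrite xoppE /wsum /word_sum sumrN. Qed.

Lemma xconst_wsum p c : xconst p * wsum c = wsum (fun w => p * c w).
Proof.
by apply/funext => A; rewrite xconst_mul xscaleE /wsum /word_sum mulr_sumr.
Qed.

Lemma eq_wsum c d : c =1 d -> wsum c = wsum d.
Proof. by move=> eqcd; apply/funext => A; apply: eq_bigr. Qed.

Lemma xone_wsum : 1 = wsum (fun w => (nilp w)%:R).
Proof.
apply/funext => A; rewrite xoneE; case: eqP => [->|/eqP A0].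
  by rewrite wsum_mset0.
rewrite /wsum /word_sum big_seq big1 // => w; rewrite mem_permutations.
by move/perm_size; rewrite /nilp => ->; rewrite size_mset_eq0 (negPf A0).
Qed.

Lemma xvar_wsum a c :
  xvar a * wsum c =
  wsum (fun w => if w is b :: w' then (b == a)%:R * c w' else 0).
Proof.
apply/funext => A; rewrite xvar_mulE /wsum /word_sum.
rewrite [RHS](bigID (fun w => ohead w == Some a)) /=.
rewrite [X in _ + X]big1 ?addr0; last first.
  by case=> //= b w; rewrite (inj_eq Some_inj) => /negPf->; rewrite mul0r.
case: ifP => aA; last first.
  rewrite big_seq_cond big1 // => -[|b w] //=; rewrite mem_permutations.
  rewrite (inj_eq Some_inj) => /andP[/perm_mem/(_ a)]; rewrite aA inE.
  by rewrite eq_sym => /negbT/norP[/negPf-> _].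
(* The arrangements of [A] starting with [a] are those of [A] with one [a] removed, prefixed by
   [a]. *)
have permA : perm_eq [seq w <- permutations A | ohead w == Some a]
                     [seq a :: w | w <- permutations (A `\ a)].
  apply: uniq_perm; rewrite ?filter_uniq ?permutations_uniq //.
    by rewrite map_inj_uniq ?permutations_uniq // => v w [].
  have pA := @perm_msubset A [mset a]; rewrite msub1set aA in pA.
  have {}pA : perm_eq A (a :: (A `\ a)).
    by rewrite (permPl (pA isT)) enum_msetn.
  move=> w; rewrite mem_filter mem_permutations; apply/andP/mapP => [[]|[v]].
    case: w => //= b w; rewrite (inj_eq Some_inj) => /eqP->.
    rewrite (permPr pA) perm_cons => pw; exists w => //.
    by rewrite mem_permutations.
  by rewrite mem_permutations => pv ->; rewrite (permPr pA) perm_cons /= eqxx.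
rewrite [RHS](eq_bigl (fun w => ohead w == Some a)) //.
rewrite -[RHS]big_filter (perm_big _ permA) big_map.
by apply: eq_bigr => w _; rewrite eqxx mul1r.
Qed.

(** Indices start at 0 and values at 1, so [val b <= j] says that [b] is among the [j] smallest
    letters. *)
Definition nth_letter (j : nat) : letter := exist _ j.+1 isT.

Lemma nth_letterK a : nth_letter (val a).-1 = a.
Proof. by apply: val_inj; case: a => -[]. Qed.

(** * Smirnov words with prescribed last letter, by linear descents *)

Section Chains.
Variables (t : R) (r : letter).
Implicit Types (j : nat) (b : letter) (w : seq letter).

(* [des_weight b w] is [t ^+ des (b :: w)] if [b :: w] is Smirnov, and [0] otherwise. *)
Fixpoint des_weight b w : R :=
  if w is c :: w' then
    (if (val c < val b)%N then t else (c != b)%:R) * des_weight c w'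
  else 1.

Definition chain b w : R := (last b w == r)%:R * des_weight b w.

Definition starts b : xseries R :=
  wsum (fun w => if w is c :: w' then (c == b)%:R * chain c w' else 0).

(* The series [P_j] of the header. *)
Definition lower j : xseries R :=
  wsum (fun w => if w is c :: w'
                 then chain c w' * (if (val c <= j)%N then t else 1) else 0).

(** Only the words whose first letter has index [j] change weight, gaining a factor [t]. *)
Lemma lowerS j :
  lower j.+1 = lower j - (1 - xconst t) * starts (nth_letter j).
Proof.
rewrite -xconst1 -xconstB xconst_wsum wsumN wsumD; apply: eq_wsum => -[|c w].
  by rewrite mulr0 subr0.
rewrite -val_eqE /= leq_eqVlt ltnS.
case: eqP => [->|_]; rewrite ?ltnn /=; last by rewrite mul0r mulr0 subr0.
by rewrite mulr1; ring.
Qed.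

(** Deleting the first letter leaves the empty word, if that letter is [r], or a word with another
    first letter. In [lower j] the factor [t] sits exactly where the deleted letter made a
    descent. *)
Lemma startsE j :
  starts (nth_letter j) = xvar (nth_letter j) *
    (lower j - starts (nth_letter j) + (nth_letter j == r)%:R).
Proof.
have -> : (nth_letter j == r)%:R = xconst (nth_letter j == r)%:R :> xseries R.
  by case: eqP => _; [rewrite xconst1 | apply/esym/scale0r].
rewrite -[xconst _]mulr1 xone_wsum xconst_wsum wsumN !wsumD xvar_wsum.
apply: eq_wsum => -[|c w] //; case: eqP => [->|_]; rewrite ?mul0r // !mul1r.
case: w => [|b w]; rewrite /chain /=; first by rewrite subr0 add0r.
rewrite mulr0 addr0 ltnS.
have [->|neb] := eqVneq b (nth_letter j); first by rewrite /= ltnn; ring.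
by case: ifP => _ /=; ring.
Qed.

Lemma lower_step j :
  lower j.+1 * (1 + xvar (nth_letter j)) =
  lower j * (1 + xconst t * xvar (nth_letter j)) -
  (1 - xconst t) * (nth_letter j == r)%:R * xvar (nth_letter j).
Proof.
rewrite lowerS; have := startsE j.
move: (starts _) (lower j) (xvar _) (xconst t) (_%:R) => s l x c d sE.
(* [startsE] amounts to s + x s = x (l + d), which eliminates [s]. *)
transitivity ((l * (1 + x) - (1 - c) * (s + x * s))); first by ring.
by rewrite {1}sE; ring.
Qed.

Lemma eset_leS p j :
  eset p (fun b => val b <= j.+1)%N =
  eset p (fun b => val b <= j)%N * (1 + xconst p * xvar (nth_letter j)).
Proof.
rewrite -eset1 esetU => [|b] /=.
  by apply: eset_eq => b /=; rewrite -val_eqE /= leq_eqVlt ltnS orbC.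
by rewrite -val_eqE /=; case: eqP => [->|]; rewrite ?ltnn ?andbF.
Qed.

Lemma eset_gtS p j :
  eset p (fun b => j < val b)%N =
  (1 + xconst p * xvar (nth_letter j)) * eset p (fun b => j.+1 < val b)%N.
Proof.
rewrite -eset1 esetU => [|b] /=.
  by apply: eset_eq => b /=; rewrite -val_eqE /= leq_eqVlt eq_sym.
by rewrite -val_eqE /=; case: eqP => [->|]; rewrite ?ltnn.
Qed.

(** The telescoping quantity: P_j times 1 + x_a for the letters already passed and 1 + t x_a for the
    others. By [lower_step] it changes only on passing [r]. *)
Definition mixed j : xseries R :=
  lower j * (eset 1 (fun b => val b <= j)%N * eset t (fun b => j < val b)%N).

Lemma mixedS j :
  mixed j.+1 = mixed j -
    (1 - xconst t) * (nth_letter j == r)%:R * xvar (nth_letter j) *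
    (eset 1 (fun b => val b <= j)%N * eset t (fun b => j.+1 < val b)%N).
Proof.
rewrite /mixed eset_leS xconst1 mul1r [eset t (fun b => j < _)%N]eset_gtS.
have := lower_step j; move: (eset _ _) (eset _ _) (lower j) (lower j.+1) => e f l l'.
move: (xvar _) (xconst t) (_%:R) => x c d E.
by transitivity (l' * (1 + x) * (e * f)); [ring | rewrite E; ring].
Qed.

Let idx_r := (val r).-1.

Definition defect : xseries R :=
  (1 - xconst t) * xvar r *
  (eset 1 (fun b => val b < val r)%N * eset t (fun b => val r < val b)%N).

Lemma nth_letter_eq j : (nth_letter j == r) = (j == idx_r).
Proof. by rewrite /idx_r -val_eqE /=; case: r => -[]. Qed.

Lemma mixed_le j : (j <= idx_r)%N -> mixed j = mixed 0.
Proof.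
elim: j => // j IHj ltj; rewrite mixedS IHj ?(ltnW ltj) // nth_letter_eq.
by rewrite ltn_eqF // mulr0 !mul0r subr0.
Qed.

Lemma mixed_gt j : (idx_r < j)%N -> mixed j = mixed 0 - defect.
Proof.
elim: j => // j IHj; rewrite ltnS leq_eqVlt => /predU1P[<-|lti].
  rewrite mixedS (mixed_le (leqnn idx_r)) nth_letter_eq eqxx
    (mulr1 (1 - xconst t)) nth_letterK /defect.
  have -> : eset 1 (fun b => val b < val r)%N = eset 1 (fun b => val b <= idx_r)%N.
    by apply: eset_eq => b; rewrite /idx_r; case: r => -[].
  have -> : eset t (fun b => val r < val b)%N = eset t (fun b => idx_r.+1 < val b)%N.
    by apply: eset_eq => b; rewrite /idx_r; case: r => -[].
  by [].
rewrite mixedS (IHj lti) nth_letter_eq (gtn_eqF lti).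
by rewrite mulr0 !mul0r subr0.
Qed.

Lemma eset_pred0 p (I : pred letter) : I =1 pred0 -> eset p I = 1.
Proof.
move=> I0; apply/funext => A; rewrite xoneE.
have [->|A0] := eqVneq A mset0; first by rewrite eset0.
rewrite /eset; case: uniq_all_msetP => // leA; case/eqP: A0; apply/msetP => a.
by have := leA a; rewrite I0 mset0E; case: (A a).
Qed.

Lemma mixed0 : mixed 0 = lower 0 * eset t predT.
Proof.
rewrite /mixed [eset 1 _]eset_pred0 ?mul1r => [|b]; last by case: b => -[].
by congr (_ * _); apply: eset_eq => b; case: b => -[].
Qed.

Lemma eset_bounded p (I J : pred letter) A B :
    (B `<=` A)%mset -> {in A, I =1 J} -> eset p I B = eset p J B.
Proof.
move=> /msubset_subset sBA eqIJ; rewrite /eset.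
by congr (if _ && _ then _ else _); apply: eq_in_all => a /sBA/eqIJ.
Qed.

(** The coefficientwise form of P_oo = t P_0: once [j] bounds all letters of [A], every first letter
    earns [t] in [lower j], and none does in [lower 0]. *)
Lemma lower_bounded j A B :
    (B `<=` A)%mset -> {in A, forall a, (val a <= j)%N} ->
  lower j B = (xconst t * lower 0) B.
Proof.
move=> /msubset_subset sBA leAj; rewrite xconst_wsum /lower /wsum /word_sum.
rewrite big_seq [RHS]big_seq; apply: eq_bigr => -[|c w]; first by rewrite mulr0.
rewrite mem_permutations => /perm_mem/(_ c); rewrite inE eqxx => /esym/sBA/leAj->.
by case: ifP => [|_]; [case: c => -[] | rewrite mulr1 mulrC].
Qed.

Lemma mixed_bounded j A : {in A, forall a, (val a <= j)%N} ->
  mixed j A = (xconst t * lower 0 * eset 1 predT) A.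
Proof.
move=> leAj; apply: eq_xmul => B sBA; first exact: lower_bounded sBA leAj.
rewrite -[X in _ = X B]mulr1; apply: eq_xmul => C sCB.
  by apply: (eset_bounded _ (msubset_trans sCB sBA)) => a /leAj->.
rewrite -(@eset_pred0 t pred0) //.
by apply: (eset_bounded _ (msubset_trans sCB sBA)) => a /leAj; rewrite leqNgt => /negPf.
Qed.

Lemma lower_defect :
  lower 0 * (eset t predT - xconst t * eset 1 predT) = defect.
Proof.
suff E : mixed 0 - defect = xconst t * lower 0 * eset 1 predT.
  transitivity (lower 0 * eset t predT - xconst t * lower 0 * eset 1 predT).
    by ring.
  by rewrite -E mixed0; ring.
(* This [j] lies beyond [idx_r], so [mixed] has dropped by [defect], and it bounds all letters of
   [A], so the limit is reached at [A]. *)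
apply/funext => A; pose j := maxn idx_r.+1 (\max_(a <- A) val a).
rewrite -(@mixed_bounded j) => [|a aA].
  have ltj : (idx_r < j)%N by exact: leq_maxl.
  by rewrite (mixed_gt ltj).
by rewrite leq_max [X in _ || X](leq_bigmax_seq _ aA) ?orbT.
Qed.

(** At [idx_r] the factor [t] marks a first letter below [r], that is, the descent from last to
    first letter. There [mixed] still equals [mixed 0], which [lower_defect] evaluates; the partial
    products [e1] and [et] have constant term 1 and cancel. *)
Lemma lower_mul_eset :
  lower idx_r * (eset t predT - xconst t * eset 1 predT) =
  (1 - xconst t) * (xvar r * eset t (predC1 r)).
Proof.
set e1 := eset 1 (fun b => val b <= idx_r)%N.
set et := eset t (fun b => idx_r < val b)%N.
apply: (@xmul_cancel et); first exact: eset0.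
apply: (@xmul_cancel e1); first exact: eset0.
have ltr b : (val b <= idx_r)%N = (val b < val r)%N by rewrite /idx_r; case: r => -[].
transitivity (mixed idx_r * (eset t predT - xconst t * eset 1 predT)).
  by rewrite /mixed -/e1 -/et; ring.
rewrite (mixed_le (leqnn idx_r)) mixed0 mulrAC lower_defect /defect.
rewrite -(eset_eq _ ltr) -/e1.
have -> : eset t predT = eset t (fun b => val b <= idx_r)%N * et.
  rewrite esetU => [|b] /=; last by rewrite leqNgt andNb.
  by apply: eset_eq => b /=; rewrite leqNgt orNb.
have -> : eset t (predC1 r) =
    eset t (fun b => val b <= idx_r)%N * eset t (fun b => val r < val b)%N.
  rewrite esetU => [|b] /=; last first.
    by rewrite ltr; case: ltngtP.
  by apply: eset_eq => b /=; rewrite ltr -val_eqE neq_ltn.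
by ring.
Qed.
End Chains.
End XSeries.

(** * Cyclic descents, by summing over the last letter *)

Section CyclicGF.
Variables (R : comNzRingType) (t : R).
Implicit Types (A B : {mset letter}) (r : letter).

Definition cyclic_gf : xseries R :=
  wsum (fun w => if w is a :: w' then
    des_weight t a w' * (if (val a < val (last a w'))%N then t else 1) else 0).

(** Only letters of [A] can end a word whose monomial divides [A], so a finite sum replaces the sum
    over all last letters. *)
Lemma cyclic_gf_lower A B : (B `<=` A)%mset ->
  cyclic_gf B = (\sum_(r <- undup A) lower t r (val r).-1) B.
Proof.
move=> /msubset_subset sBA; rewrite xsumE /cyclic_gf /lower /wsum /word_sum.
rewrite exchange_big big_seq [RHS]big_seq; apply: eq_bigr => -[|a w].
  by rewrite big1.
rewrite mem_permutations => /perm_mem eqB.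
have lA : last a w \in undup A by rewrite mem_undup sBA // -eqB mem_last.
rewrite (bigD1_seq _ lA) ?undup_uniq //= big1 ?addr0 => [|r].
  by rewrite /chain eqxx mul1r; case: (last a w) => -[].
by rewrite /chain eq_sym => /negPf->; rewrite !mul0r.
Qed.

(** The sum over r of x_r \prod_(a <> r) (1 + t x_a): a squarefree monomial arises once for each of
    its letters. *)
Definition marked_eset : xseries R :=
  fun A => if uniq A then (size A)%:R * t ^+ (size A).-1 else 0.

Lemma xvar_eset_predC1 r A : r \in A ->
  (xvar R r * eset t (predC1 r)) A = if uniq A then t ^+ (size A).-1 else 0.
Proof.
move=> rA; rewrite xvar_mulE rA /eset.
have -> : size (A `\ r) = (size A).-1.
  have /size_msubset -> : ([mset r] `<=` A)%mset by rewrite msub1set.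
  by rewrite enum_msetn.
congr (if _ then _ else _); rewrite in_mset in rA.
apply/uniq_all_msetP/mset_uniqP => leA a; have := leA a;
  by rewrite msetB1E /=; case: eqP => [->|] /=; lia.
Qed.

Lemma cyclic_gf_mul :
  cyclic_gf * (eset t predT - xconst t * eset 1 predT) =
  xconst (1 - t) * marked_eset.
Proof.
apply/funext => A.
rewrite (eq_xmul (@cyclic_gf_lower A) (fun B _ => erefl _)).
rewrite mulr_suml xsumE [in RHS]xconst_mul [in RHS]xscaleE.
under eq_bigr do rewrite lower_mul_eset -xconst1 -xconstB xconst_mul xscaleE.
rewrite -mulr_sumr big_seq; congr (_ * _).
under eq_bigr => r do rewrite mem_undup => /xvar_eset_predC1->.
rewrite -big_seq /marked_eset; case: ifP => uA; last by rewrite big1.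
by rewrite undup_id // big_const_seq count_predT iter_addr_0 mulr_natl.
Qed.

Definition kernel_eset : xseries R :=
  fun A => if uniq A && (1 < size A)%N
           then t * \sum_(j < (size A).-1) t ^+ j else 0.

(** At a squarefree monomial of degree n the left side is t^n - t for n > 0, which is 0 for n = 1
    and -(1 - t) t [n-1]_t for n >= 2; in degree 0 it is 1 - t. *)
Lemma eset_kernel :
  eset t predT - xconst t * eset 1 predT = xconst (1 - t) * (1 - kernel_eset).
Proof.
apply/funext => A.
rewrite !xconst_mul xaddE xoppE !xscaleE [X in _ = _ * X]xaddE xoppE xoneE.
rewrite /eset /kernel_eset all_predT andbT expr1n -size_mset_eq0.
case uA: (uniq A); last first.
  rewrite mulr0 subr0 /= subr0; case: eqP => [|_]; last by rewrite mulr0.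
  by move=> /eqP; rewrite size_mset_eq0 => /eqP A0; rewrite A0 enum_mset0 in uA.
case: (size A) => [|[|n]] /=; first by rewrite expr0; ring.
  by rewrite expr1; ring.
by rewrite exprS mulr1 -[X in _ - X]mulr1 -mulrBr subrX1; ring.
Qed.

End CyclicGF.

Lemma cyclic_gf_rec (D : idomainType) (t : D) : t != 1 ->
  cyclic_gf t = marked_eset t + cyclic_gf t * kernel_eset t.
Proof.
move=> t1; suff E : cyclic_gf t * (1 - kernel_eset t) = marked_eset t.
  by rewrite -E; ring.
have E : xconst (1 - t) * (cyclic_gf t * (1 - kernel_eset t)) =
         xconst (1 - t) * marked_eset t.
  by rewrite -cyclic_gf_mul eset_kernel; ring.
(* The factor [1 - t] is cancelled in the domain [D], coefficient by coefficient. *)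
apply/funext => A; apply: (mulfI (x := 1 - t)); first by rewrite subr_eq0 eq_sym.
by rewrite -!xscaleE -!xconst_mul E.
Qed.

(** * Grading by degree, which restores z *)

Section Homogeneous.
Variable R : comNzRingType.
Implicit Types (f g : xseries R) (A B : {mset letter}).

(* Sends [x_a] to [x_a z]. *)
Definition homog f : zseries (xseries R) :=
  fun n A => if size A == n then f A else 0.

(** Degrees add along a factorization of [A], so for each divisor [B] only the index [i = size B]
    contributes. *)
Lemma homogM f g : homog (f * g) = homog f * homog g.
Proof.
apply/funext => n; apply/funext => A.
transitivity ((\sum_(i < n.+1) homog f i * homog g (n - i)%N) A); last by [].
rewrite xsumE.
transitivity (\sum_(i < n.+1) \sum_(B <- mdivs A)
    homog f i B * homog g (n - i)%N (A `\` B)); last by [].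
rewrite exchange_big /= /homog xmulE.
have [<-|neA] := eqVneq (size A) n; last first.
  rewrite big_seq big1 // => B; rewrite mem_mdivs => /size_msubset sA.
  rewrite big1 // => i _; case: eqP => [eqB|_]; last by rewrite mul0r.
  case: eqP => [eqC|_]; last by rewrite mulr0.
  by case/eqP: neA; rewrite sA eqB eqC subnKC // -ltnS.
rewrite big_seq [RHS]big_seq; apply: eq_bigr => B; rewrite mem_mdivs.
move=> /size_msubset sA.
have ltB : (size (B : {mset letter}) < (size A).+1)%N by rewrite ltnS sA leq_addr.
rewrite (bigD1 (Ordinal ltB)) //= eqxx [in (size A - _)%N]sA addKn eqxx.
rewrite big1 ?addr0 // => i.
by rewrite -val_eqE eq_sym /= => /negPf->; rewrite mul0r.
Qed.

Lemma homogD f g : homog (f + g) = homog f + homog g.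
Proof.
apply/funext => n; apply/funext => A.
transitivity (homog f n A + homog g n A); last by [].
by rewrite /homog; case: ifP; rewrite ?addr0.
Qed.

(** A squarefree monomial has exactly one increasing arrangement, its sorted one; a monomial with a
    repeated letter has none. *)
Lemma elem_symE i A : elem_sym R i A = if uniq A && (size A == i) then 1 else 0.
Proof.
rewrite /elem_sym /word_sum.
have sortedE w : sorted (fun k l : letter => (val k < val l)%N) w =
    uniq w && sorted (fun k l : letter => (val k <= val l)%N) w.
  have := ltn_sorted_uniq_leq (map val w).
  by rewrite !sorted_map (map_inj_uniq val_inj).
pose le := fun k l : letter => (val k <= val l)%N.
have leT : total le by move=> k l; apply: leq_total.
case: ifP => [/andP[uA /eqP sA]|nA]; last first.
  rewrite big_seq_cond big1 // => w /and3P[]; rewrite mem_permutations sortedE.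
  by move=> pw sw /andP[uw _]; rewrite -(perm_uniq pw) uw -(perm_size pw) sw in nA.
rewrite big_mkcond (bigD1_seq (sort le A)) ?mem_permutations ?perm_sort //=;
  last exact: permutations_uniq.
rewrite size_sort sA eqxx sortedE sort_uniq uA (sort_sorted leT) /= big_seq_cond.
rewrite big1 ?addr0 // => w /andP[]; rewrite mem_permutations => pw neq.
rewrite sortedE; case: ifP => // /and3P[_ _ sw]; case/eqP: neq.
have anti : antisymmetric le by move=> k l /anti_leq /val_inj.
apply: (sorted_eq _ anti) => //; first by move=> k l m; apply: leq_trans.
  exact: sort_sorted.
by rewrite (perm_trans pw) // perm_sym perm_sort.
Qed.

Lemma homog_marked_eset t : homog (marked_eset t) =
  zsum 1 (fun i => (i%:R * t ^+ i.-1) *: elem_sym R i).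
Proof.
apply/funext => n; apply/funext => A; rewrite /homog /zsum /marked_eset.
case: n => [|n] /=; first by case: eqP => // ->; rewrite mul0r if_same.
rewrite xscaleE elem_symE.
by case: eqP => [->|]; case: (uniq A); rewrite /= ?mulr1 ?mulr0.
Qed.

Lemma homog_kernel_eset t : homog (kernel_eset t) =
  zsum 2 (fun i => (t * \sum_(j < i.-1) t ^+ j) *: elem_sym R i).
Proof.
apply/funext => n; apply/funext => A; rewrite /homog /zsum /kernel_eset.
case: (ltnP 1 n) => le1n; last first.
  case: eqP => // sA; by rewrite sA ltnNge le1n andbF.
rewrite xscaleE elem_symE.
case: eqP => [->|_]; last by rewrite andbF mulr0.
by rewrite le1n !andbT; case: (uniq A); rewrite ?mulr1 ?mulr0.
Qed.

End Homogeneous.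

(** The closing letter [c] is independent of [a] for the induction on [w]; with [c = a] the count is
    [cdes (a :: w)]. *)
Lemma smirnov_weightE (R : comNzRingType) (t : R) a (w : seq letter) c :
  (sorted (fun k l => k != l) (a :: w))%:R *
    t ^+ count (fun p : letter * letter => (val p.2 < val p.1)%N)
           (zip (a :: w) (rcons w c)) =
  des_weight t a w * (if (val c < val (last a w))%N then t else 1).
Proof.
elim: w a => [|b w IHw] a /=; first by rewrite addn0; case: ifP; rewrite !mul1r.
rewrite -mulrA -IHw /= exprD [b == a]eq_sym.
have [->|neab] := eqVneq a b; first by rewrite ltnn /=; ring.
by case: ifP => _; rewrite ?expr1 ?expr0 /=; ring.
Qed.

Lemma homog_cyclic_gf : homog (cyclic_gf ('X : {poly int})) = zsum 1 smirnov_enum.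
Proof.
apply/funext => n; apply/funext => A; rewrite /homog /zsum.
case: n => [|n] /=.
  by case: eqP => // /eqP; rewrite size_mset_eq0 => /eqP->; apply: wsum_mset0.
rewrite /smirnov_enum /cyclic_gf /wsum /word_sum /smirnov [RHS]big_mkcond.
case: eqP => [sA|/eqP neA]; last first.
  rewrite big_seq big1 // => w; rewrite mem_permutations => /perm_size ->.
  by rewrite (negPf neA).
rewrite big_seq [RHS]big_seq; apply: eq_bigr => w.
rewrite mem_permutations => /perm_size; rewrite sA => sw; rewrite sw eqxx.
case: w sw => // a w _; rewrite -smirnov_weightE /cdes rot1_cons.
by case: (sorted _ _); rewrite ?mul1r ?mul0r.
Qed.

(** The generating function with its denominator cleared, as the image of [cyclic_gf_rec] under
    [homog]; both the quotient formula and the recurrence follow from it. *)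
Lemma zsum_smirnov_rec :
  zsum 1 smirnov_enum
    = zsum 1 (fun i => (i%:R * 'X^(i.-1) : {poly int}) *: elem_sym {poly int} i)
      + zsum 1 smirnov_enum
        * zsum 2 (fun i => ('X * t_int i.-1) *: elem_sym {poly int} i).
Proof.
rewrite -homog_cyclic_gf -homog_marked_eset -homog_kernel_eset -homogM -homogD.
rewrite -cyclic_gf_rec //; apply/eqP => /(congr1 (size \o polyseq)) /=.
by rewrite size_polyX size_poly1.
Qed.

(** * Closure properties of symmetric functions *)

Section Symmetric.
Variable R : comNzRingType.
Implicit Types (f g : xseries R) (A B : {mset letter}) (s : letter -> letter).

Definition rename_mset s A : {mset letter} := seq_mset [seq s a | a <- A].

Lemma rename_mset_inj s A a : injective s -> rename_mset s A (s a) = A a.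
Proof.
move=> inj_s; rewrite mset_seqE count_map -count_mem_mset.
by apply: eq_count => b /=; rewrite (inj_eq inj_s).
Qed.

Lemma symmetric0 : is_symmetric_function (0 : xseries R).
Proof. by split; [exists 0%N | move]. Qed.

Lemma symmetric1 : is_symmetric_function (1 : xseries R).
Proof.
split=> [|s A _].
  by exists 0%N => A; rewrite lt0n size_mset_eq0 xoneE => /negPf->.
rewrite !xoneE -!size_mset_eq0; congr (_ == _)%:R.
by rewrite (perm_size (perm_eq_seq_mset _)) size_map.
Qed.

Lemma symmetricD f g : is_symmetric_function f -> is_symmetric_function g ->
  is_symmetric_function (f + g).
Proof.
move=> [[m f0] sf] [[n g0] sg]; split=> [|s A bij_s].
  by exists (m + n)%N => A ltA; rewrite xaddE f0 ?g0 ?addr0 //; lia.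
by rewrite !xaddE sf ?sg.
Qed.

(** A bijective renaming carries the divisors of [A] onto those of the renamed monomial and commutes
    with cofactors, so the terms of the two convolutions match. *)
Lemma symmetricM f g : is_symmetric_function f -> is_symmetric_function g ->
  is_symmetric_function (f * g).
Proof.
move=> [[m f0] sf] [[n g0] sg]; split=> [|s A bij_s].
  exists (m + n)%N => A ltA; rewrite xmulE big_seq big1 // => B.
  rewrite mem_mdivs => /size_msubset sA.
  have [leB|ltB] := leqP (size (B : {mset letter})) m; last by rewrite f0 ?mul0r.
  by rewrite g0 ?mulr0 //; lia.
have inj_s := bij_inj bij_s; rewrite !xmulE.
have sB B C : rename_mset s (B `\` C) = rename_mset s B `\` rename_mset s C.
  case: bij_s => s' _ s'K; apply/msetP => a.
  by rewrite -(s'K a) msetE2 !rename_mset_inj // msetE2.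
have permA : perm_eq (mdivs (rename_mset s A)) [seq rename_mset s B | B <- mdivs A].
  apply: uniq_perm; first exact: mdivs_uniq.
    rewrite map_inj_uniq ?mdivs_uniq // => B C eqBC; apply/msetP => a.
    by rewrite -(rename_mset_inj _ _ inj_s) eqBC rename_mset_inj.
  move=> B; rewrite mem_mdivs; apply/idP/mapP => [/msubsetP sBA|[C]].
    case: bij_s (bij_s) => s' sK s'K bij_s.
    have BE : B = rename_mset s (rename_mset s' B).
      have inj_s' := can_inj s'K.
      by apply/msetP => a; rewrite -{2}(s'K a) !rename_mset_inj.
    exists (rename_mset s' B) => //; rewrite mem_mdivs; apply/msubsetP => a.
    by have := sBA (s a); rewrite {1}BE !rename_mset_inj.
  rewrite mem_mdivs => /msubsetP sCA ->; apply/msubsetP => a.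
  by case: bij_s => s' _ s'K; rewrite -(s'K a) !rename_mset_inj.
rewrite (perm_big _ permA) big_map; apply: eq_bigr => B _.
by rewrite -sB sf // sg.
Qed.

Lemma symmetric_elem_sym i : is_symmetric_function (elem_sym R i).
Proof.
split=> [|s A /bij_inj inj_s].
  by exists i => A; rewrite elem_symE; case: eqP => [->|]; rewrite ?ltnn ?andbF.
rewrite !elem_symE (perm_size (perm_eq_seq_mset _)) size_map.
by rewrite (perm_uniq (perm_eq_seq_mset _)) map_inj_uniq.
Qed.

Lemma symmetric_elem_sym_part la : is_symmetric_function (elem_sym_part R la).
Proof.
rewrite /elem_sym_part; elim/big_rec: _ => [|i f _]; first exact: symmetric1.
exact/symmetricM/symmetric_elem_sym.
Qed.

End Symmetric.

(** * Positivity in the elementary basis *)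

(* Positive coefficients are encoded as multiplicities in [Q]. *)
Definition e_sum (f : xseries int) : Prop :=
  exists2 Q : seq (seq nat), all is_intpart Q & f = \sum_(la <- Q) elem_sym_part int la.

Lemma e_sum_nonneg f : e_sum f -> e_nonneg f.
Proof.
case=> Q partQ ->; split.
  elim/big_rec: _ => [|la f' _]; first exact: symmetric0.
  exact/symmetricD/symmetric_elem_sym_part.
exists (undup Q), (fun la => (count_mem la Q)%:R); split.
- exact: undup_uniq.
- by apply/allP => la; rewrite mem_undup => /(allP partQ).
- by move=> la _; rewrite ler0n.
rewrite -big_undup_iterop_count; apply: eq_bigr => la _; rewrite scaler_nat.
by case: (count_mem la Q) => // n; rewrite Monoid.iteropE.
Qed.

Lemma e_sum0 : e_sum 0.
Proof. by exists [::]; rewrite ?big_nil. Qed.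

Lemma e_sum1 : e_sum 1.
Proof. by exists [:: [::]]; rewrite ?big_seq1 /elem_sym_part ?big_nil. Qed.

Lemma e_sumD f g : e_sum f -> e_sum g -> e_sum (f + g).
Proof.
by case=> P Pp -> [Q Qp ->]; exists (P ++ Q); rewrite ?big_cat // all_cat Pp.
Qed.

(** Each partition gains the part [i]; sorting restores the order, and [0 < i] keeps the parts
    positive. *)
Lemma e_sum_elem_symM i f : (0 < i)%N -> e_sum f -> e_sum (elem_sym int i * f).
Proof.
move=> i_gt0 [Q /allP Qp ->]; exists [seq sort geq (i :: la) | la <- Q].
  apply/allP => _ /mapP[la /Qp /andP[_ la0] ->].
  rewrite /is_intpart sort_sorted; last by move=> m n; apply: leq_total.
  by rewrite mem_sort inE negb_or la0 eq_sym -lt0n i_gt0.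
rewrite mulr_sumr big_map; apply: eq_bigr => la _.
by rewrite /elem_sym_part (perm_big _ (permEl (perm_sort geq (i :: la)))) big_cons.
Qed.

Definition e_sum_poly (F : xseries {poly int}) : Prop := forall k, e_sum (t_coef k F).

Lemma e_sum_polyD F G : e_sum_poly F -> e_sum_poly G -> e_sum_poly (F + G).
Proof.
move=> eF eG k; have -> : t_coef k (F + G) = t_coef k F + t_coef k G.
  by apply/funext => A; rewrite /t_coef xaddE coefD.
exact: e_sumD.
Qed.

Lemma e_sum_poly0 : e_sum_poly 0.
Proof.
move=> k; have -> : t_coef k 0 = 0 by apply/funext => A; apply: coef0.
exact: e_sum0.
Qed.

Lemma e_sum_poly1 : e_sum_poly 1.
Proof.
move=> k; have -> : t_coef k 1 = if k == 0%N then 1 else 0.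
  apply/funext => A; rewrite /t_coef xoneE; have [->|k0] := eqVneq k 0%N.
    by rewrite xoneE; case: eqP; rewrite ?coef1 ?coef0.
  by case: eqP; rewrite ?coef1 ?coef0 ?(negPf k0).
by case: eqP => _; [exact: e_sum1 | exact: e_sum0].
Qed.

Lemma e_sum_poly_sum (I : Type) (r : seq I) (P : pred I) (F : I -> xseries {poly int}) :
  (forall i, P i -> e_sum_poly (F i)) -> e_sum_poly (\sum_(i <- r | P i) F i).
Proof.
by move=> eF; elim/big_ind: _ => //; [exact: e_sum_poly0 | exact: e_sum_polyD].
Qed.

(** The coefficients of e_i are constant in t, so multiplication by e_i commutes with [t_coef],
    while t^j shifts the index by [j]. *)
Lemma e_sum_poly_elem_symM i j F : (0 < i)%N -> e_sum_poly F ->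
  e_sum_poly (('X^j *: elem_sym {poly int} i) * F).
Proof.
move=> i_gt0 eF k.
have -> : t_coef k (('X^j *: elem_sym {poly int} i) * F) =
    if (k < j)%N then 0 else elem_sym int i * t_coef (k - j) F.
  apply/funext => A; rewrite /t_coef xscaleAl xscaleE coefXnM.
  case: ifP => // _; rewrite !xmulE coef_sum; apply: eq_bigr => B _.
  by rewrite !elem_symE; case: ifP; rewrite ?mul1r ?mul0r ?coef0.
case: ifP => _; first exact: e_sum0.
exact: e_sum_elem_symM.
Qed.

Lemma smirnov_enum_rec n : (0 < n)%N ->
  smirnov_enum n = (n%:R * 'X^(n.-1) : {poly int}) *: elem_sym {poly int} n +
    \sum_(i < n.+1) zsum 1 smirnov_enum i *
      zsum 2 (fun i => ('X * t_int i.-1) *: elem_sym {poly int} i) (n - i)%N.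
Proof.
move=> n_gt0; have E := congr1 (fun f => f n) zsum_smirnov_rec.
have zsumn (a : nat -> xseries {poly int}) : zsum 1 a n = a n by rewrite /zsum n_gt0.
rewrite zsumn in E; rewrite {1}E.
by rewrite -(zsumn (fun i => (i%:R * 'X^(i.-1) : {poly int}) *: elem_sym {poly int} i)).
Qed.

Lemma e_sum_poly_smirnov n : (0 < n)%N -> e_sum_poly (smirnov_enum n).
Proof.
have [m] := ubnP n; elim: m n => // m IHm n; rewrite ltnS => lenm n_gt0.
rewrite smirnov_enum_rec //; apply: e_sum_polyD.
  (* The first term is split into n copies of t^(n-1) e_n. *)
  rewrite mulr_natl -scalerMnl -[X in _ *+ X]card_ord -sumr_const.
  apply: e_sum_poly_sum => i _; rewrite -[_ *: _]mulr1.
  exact/e_sum_poly_elem_symM/e_sum_poly1.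
apply: e_sum_poly_sum => i _; rewrite /zsum.
(* Terms with i = 0 or n - i < 2 vanish; the others have 0 < i < n, so the induction hypothesis
   applies. *)
case: ltnP => [i_gt0|_]; last by rewrite mul0r; apply: e_sum_poly0.
case: ltnP => [lti|_]; last by rewrite mulr0; apply: e_sum_poly0.
rewrite mulrC /t_int mulr_sumr scaler_suml mulr_suml.
apply: e_sum_poly_sum => j _; rewrite -exprS.
apply: e_sum_poly_elem_symM; first by lia.
by apply: IHm => //; lia.
Qed.

Lemma smirnov_enum_degree n k : (n < k)%N -> t_coef k (smirnov_enum n) = 0.
Proof.
move=> ltnk; apply/funext => A; rewrite /t_coef /smirnov_enum /word_sum coef_sum.
apply: big1 => w /andP[/eqP sw _]; rewrite coefXn gtn_eqF //.
apply: leq_ltn_trans ltnk; rewrite (leq_trans (count_size _ _)) //.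
by rewrite size_zip size_rot minnn sw.
Qed.

Theorem corollary2p5 :
  zsum 1 smirnov_enum
    = zsum 1 (fun i => (i%:R * 'X^(i.-1) : {poly int}) *: elem_sym {poly int} i)
      / (1 - zsum 2 (fun i => ('X * t_int i.-1) *: elem_sym {poly int} i))
  /\ (forall n : nat, (1 <= n)%N -> e_positive (smirnov_enum n)).
Proof.
split=> [|n n_gt0].
  (* The sum in the denominator starts at 2 > 0, so the denominator is a unit and can be cleared. *)
  apply: (canRL (mulrK (zsum_unit _ _))) => //.
  by rewrite mulrBr mulr1 {1}zsum_smirnov_rec addrK.
split; first by exists n => k; apply: smirnov_enum_degree.
by move=> k; apply/e_sum_nonneg/e_sum_poly_smirnov.
Qed.
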